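(* Let $d\ge1$ and $m\ge 1$ be integers, let $P$ be a probability measure on $[0,1]^d$ with density $p$ satisfying $0<\inf p\le\sup p<\infty$, and let $k(x,y)=\phi(\|x-y\|_2^2)$ be a radial kernel on $[0,1]^d$, where $\phi$ is a smooth function with Taylor series expansion $\phi(u)=\sum_{\ell=0}^\infty\frac{a_\ell}{\ell!}u^\ell$ for $u\in[0,d]$. Then $$\sup_{x\in[0,1]^d}\big\|L_kW_m^x-k_x\big\|_\infty\le\big(1+c_p^{1/2}m^d\big)\sum_{\ell=\lfloor\frac{m-1}{2}\rfloor+1}^\infty\frac{|a_\ell|}{\ell!}\,d^{\ell}.$$
   Context: Here $k_x(\cdot)=k(x,\cdot)$, $c_p=\sup_{z\in[0,1]^d}p(z)^{-1}$, $\|\cdot\|_\infty$ is the supremum norm on $[0,1]^d$, $\lfloor\cdot\rfloor$ is the floor function, and $L_k$ is the integral operator $(L_kf)(y)=\int_{[0,1]^d}k(z,y)f(z)p(z)\,dz$ on $L^2([0,1]^d,P)$. For $x\in[0,1]$ let $w_m^x(z)=\sum_{i=1}^m\alpha_{x,i}z^{i-1}$, where $\alpha_x\in\mathbb{R}^m$ solves $H_m\alpha_x=(1,x,\dots,x^{m-1})^\top$ with the Hilbert matrix $H_m=\big(\frac1{i+j-1}\big)_{i,j=1}^m$. For $x=(x_1,\dots,x_d)\in[0,1]^d$ define $$W_m^x(z_1,\dots,z_d)=\Big(\prod_{i=1}^d w_m^{x_i}(z_i)\Big)\,p(z_1,\dots,z_d)^{-1}.$$ *)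

(* Defs.v *)
From HB Require Import structures.
From mathcomp Require Import all_boot all_order all_algebra.
From mathcomp Require Import all_classical all_reals all_analysis.

Set Implicit Arguments.
Unset Strict Implicit.
Unset Printing Implicit Defensive.

Import Order.TTheory GRing.Theory Num.Theory.
Import numFieldNormedType.Exports.

Local Open Scope classical_set_scope.
Local Open Scope ring_scope.

(* Points of R^n are n-tuples, with the product sigma-algebra.                *)
(* Lebesgue measure on R^n is obtained by recursion on n from binary          *)
(* products, transported along the bijection R * R^n -> R^(n+1).              *)
Section lebesgue_tuple.
Context {R : realType}.
Local Notation T := (measurableTypeR R).

Definition consT n (x : T * n.-tuple T) : n.+1.-tuple T :=
  [tuple of x.1 :: x.2].

Lemma measurable_consT n : measurable_fun [set: T * n.-tuple T] (@consT n).
Proof. exact: measurable_cons. Qed.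

Section step.
Local Open Scope ereal_scope.
Variables (n : nat) (mu : {sigma_finite_measure set (n.-tuple T) -> \bar R}).

Definition lebesgue_cons : set (n.+1.-tuple T) -> \bar R :=
  pushforward (@lebesgue_measure R \x mu) (@consT n).

Let preimage_consT (A : set (n.+1.-tuple T)) :
  measurable A -> measurable (@consT n @^-1` A).
Proof.
by move=> mA; rewrite -[X in measurable X]setTI; exact: measurable_consT.
Qed.

Let lebesgue_cons0 : lebesgue_cons set0 = 0.
Proof. by rewrite /lebesgue_cons /pushforward preimage_set0 measure0. Qed.

Let lebesgue_cons_ge0 A : 0 <= lebesgue_cons A.
Proof. by rewrite /lebesgue_cons /pushforward measure_ge0. Qed.

Let lebesgue_cons_sigma_additive : semi_sigma_additive lebesgue_cons.
Proof.
move=> F mF tF mUF; rewrite /lebesgue_cons /pushforward preimage_bigcup.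
apply: measure_semi_sigma_additive.
- by move=> i; exact: preimage_consT.
- apply/trivIsetP => /= i j _ _ ij; rewrite -preimage_setI.
  by move/trivIsetP : tF => /(_ _ _ _ _ ij) ->//; rewrite preimage_set0.
- by rewrite -preimage_bigcup; exact: preimage_consT.
Qed.

HB.instance Definition _ := isMeasure.Build _ _ _ lebesgue_cons
  lebesgue_cons0 lebesgue_cons_ge0 lebesgue_cons_sigma_additive.

Let lebesgue_cons_sigma_finite : sigma_finite setT lebesgue_cons.
Proof.
have /sigma_finiteP[F [FT ndF Foo]] := sigma_finiteT (@lebesgue_measure R).
have /sigma_finiteP[G [GT ndG Goo]] := sigma_finiteT mu.
pose g (t : n.+1.-tuple T) : T * n.-tuple T := (thead t, [tuple of behead t]).
have mg : measurable_fun setT g.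
  apply: measurable_fun_pair; first exact: measurable_tnth.
  exact: measurable_behead.
have consTK x : g (consT x) = x by case: x => a b; congr pair; exact/val_inj.
exists (fun i => g @^-1` (F i `*` G i)).
  apply/esym; rewrite -subTset => t _.
  have [i _ Fi] : (\bigcup_i F i) (g t).1 by rewrite -FT.
  have [j _ Gj] : (\bigcup_i G i) (g t).2 by rewrite -GT.
  exists (maxn i j) => //; split.
  - by move: Fi; exact/subsetPset/ndF/leq_maxl.
  - by move: Gj; exact/subsetPset/ndG/leq_maxr.
move=> i; have [mFi Fi] := Foo i; have [mGi Gi] := Goo i; split.
  by rewrite -[X in measurable X]setTI; apply: mg => //; exact: measurableX.
rewrite /lebesgue_cons /pushforward -comp_preimage.
rewrite (_ : g \o @consT n = id); last by apply/funext => x; exact: consTK.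
by rewrite preimage_id product_measure1E// lte_mul_pinfty// ge0_fin_numE.
Qed.

HB.instance Definition _ := Measure_isSigmaFinite.Build _ _ _ lebesgue_cons
  lebesgue_cons_sigma_finite.

End step.

Fixpoint lebesgue_tuple n : {sigma_finite_measure set (n.-tuple T) -> \bar R} :=
  match n with
  | 0 => \d_ [tuple]
  | n'.+1 => lebesgue_cons (lebesgue_tuple n')
  end.

End lebesgue_tuple.

Notation "'pt[' R ]_ n" := (n.-tuple (measurableTypeR R))
  (at level 8, n at level 2, format "'pt[' R ]_ n") : type_scope.

Section setting.
Context {R : realType}.

Definition cube (d : nat) : set pt[R]_d :=
  [set x | forall i, 0 <= tnth x i <= 1].
Arguments cube : clear implicits.

Definition dist2 d (x y : pt[R]_d) : R :=
  \sum_(i < d) (tnth x i - tnth y i) ^+ 2.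

(* f is infinitely differentiable on D, where only increments staying in D    *)
(* are considered (so derivatives at endpoints of an interval are one-sided). *)
Definition smooth_on (D : set R) (f : R -> R) :=
  exists2 df : nat -> R -> R, forall x, D x -> df 0%N x = f x &
    forall n x, D x ->
      (df n y - df n x) / (y - x) @[y --> within D x^'] --> df n.+1 x.

Definition radial_kernel d (phi : R -> R) (x y : pt[R]_d) : R :=
  phi (dist2 x y).

Definition has_density d (P : probability pt[R]_d R) (p : pt[R]_d -> R) :=
  [/\ measurable_fun (cube d) p, (forall x, cube d x -> 0 <= p x) &
    forall A, measurable A ->
      P A = (\int[lebesgue_tuple d]_(z in A `&` cube d) (p z)%:E)%E].

(* Extended-real valued, so no default value hides a failure of integrability.*)
Definition integral_op d (p : pt[R]_d -> R) (k : pt[R]_d -> pt[R]_d -> R)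
    (f : pt[R]_d -> R) (y : pt[R]_d) : \bar R :=
  (\int[lebesgue_tuple d]_(z in cube d) (k z y * f z * p z)%:E)%E.

Definition supnorm d (f : pt[R]_d -> \bar R) : \bar R :=
  ereal_sup [set `|f y|%E | y in cube d].

Definition inv_density_sup d (p : pt[R]_d -> R) : R :=
  sup [set (p z)^-1 | z in cube d].

Definition hilbert_mx m : 'M[R]_m :=
  \matrix_(i < m, j < m) (i + j + 1)%:R^-1.

(* hilbert_mx m is invertible, so this is the solution of                     *)
(* hilbert_mx m *m alpha = (1, x, ..., x^(m-1))^T.                            *)
Definition alpha m (x : R) : 'cV[R]_m :=
  invmx (hilbert_mx m) *m \col_(i < m) x ^+ i.

Definition w m (x z : R) : R := \sum_(i < m) alpha m x i 0 * z ^+ i.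

Definition W d (p : pt[R]_d -> R) m (x z : pt[R]_d) : R :=
  (\prod_(i < d) w m (tnth x i) (tnth z i)) * (p z)^-1.

End setting.

Arguments cube {R} d _.
Arguments radial_kernel {R} d phi x y.

(* Main.v *)
(* On [0,1]^d the density cancels, so L_k W - k_x integrates
   phi(|z - y|^2) against prod_i w(x_i, z_i).  Split phi into its Taylor
   polynomial of degree n = floor((m-1)/2) and a remainder bounded by the tail.
   The polynomial part has degree <= 2n < m in each z_i, hence is reproduced
   exactly, one coordinate at a time by Fubini.  The remainder contributes at
   most tail * (1 + (sup_x int_0^1 |w(x,t)| dt)^d).  Cauchy-Schwarz (as AM-GM) and
   the reproducing property give (int |w|)^2 <= int w^2 = w(x,x), and expanding
   in the orthonormal shifted Legendre polynomials e_j, which satisfy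
   e_j^2 <= 2j+1 on [0,1], w(x,x) = sum_(j<m) e_j(x)^2 <= m^2.  Finally c_p >= 1
   because p integrates to 1 over a cube of volume 1. *)
Require Import Defs.
From HB Require Import structures.
From mathcomp Require Import all_boot all_order all_algebra.
From mathcomp Require Import all_classical all_reals all_analysis.
From mathcomp Require Import measurable_realfun ring lra.
Set Implicit Arguments.
Unset Strict Implicit.
Unset Printing Implicit Defensive.
Import Order.TTheory GRing.Theory Num.Theory.
Import numFieldNormedType.Exports.
Local Open Scope classical_set_scope.
Local Open Scope ring_scope.

(** * Integration over [0,1] as algebra on polynomials, and Legendre bounds *)

Section poly01.
Context {R : realType}.
Implicit Types p q r : {poly R}.

(** Integral over [0,1], given on coefficients so that integration by parts and orthogonality stay
    inside polynomial algebra; [integral_poly01] ties it to the Lebesgue integral. *)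
Definition int01 p : R := \sum_(i < size p) p`_i / i.+1%:R.

Lemma int01_widen n p : (size p <= n)%N ->
  int01 p = \sum_(i < n) p`_i / i.+1%:R.
Proof.
move=> pn; rewrite /int01 (big_ord_widen n (fun i => p`_i / i.+1%:R) pn).
rewrite big_mkcond; apply: eq_bigr => i _; case: ltnP => // /(nth_default 0) ->.
by rewrite mul0r.
Qed.

Lemma int01_is_linear : linear_for *%R int01.
Proof.
move=> a p q; pose n := maxn (size p) (size q).
have pn : (size p <= n)%N by exact: leq_maxl.
have qn : (size q <= n)%N by exact: leq_maxr.
have pqn : (size (a *: p + q)%R <= n)%N.
  rewrite (leq_trans (size_polyD _ _))// geq_max qn andbT.
  exact: leq_trans (size_scale_leq _ _) pn.
rewrite !(int01_widen pn, int01_widen qn, int01_widen pqn).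
rewrite mulr_sumr -big_split; apply: eq_bigr => i _ /=.
by rewrite coefD coefZ mulrDl mulrA.
Qed.

HB.instance Definition _ :=
  GRing.isLinear.Build R {poly R} R _ int01 int01_is_linear.

Lemma int01Xn n : int01 'X^n = n.+1%:R^-1.
Proof.
rewrite (@int01_widen n.+1) ?size_polyXn// big_ord_recr /= coefXn eqxx mul1r.
by rewrite big1 ?add0r// => i _; rewrite coefXn ltn_eqF// mul0r.
Qed.

Lemma int01C (c : R) : int01 c%:P = c.
Proof.
by rewrite (@int01_widen 1) ?size_polyC ?leq_b1// big_ord1 coefC divr1.
Qed.

Lemma int01_deriv p : int01 p^`() = p.[1] - p.[0].
Proof.
rewrite (@int01_widen (size p).-1); last first.
  have [->|p0] := eqVneq p 0; first by rewrite deriv0 size_poly0.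
  by rewrite -ltnS (leq_trans (lt_size_deriv p0))// leqSpred.
rewrite horner_coef0 horner_coef.
under [in RHS]eq_bigr do rewrite expr1n mulr1.
case: (size p) (nth_default 0 (leqnn (size p))) => [|n] /=.
  by rewrite !big_ord0 => ->; rewrite subrr.
move=> _; rewrite big_ord_recl addrC addKr; apply: eq_bigr => i _.
by rewrite coef_deriv -(mulr_natr p`_i.+1) mulfK ?pnatr_eq0.
Qed.

Lemma int01_by_parts p q :
  int01 (p^`() * q) = (p * q).[1] - (p * q).[0] - int01 (p * q^`()).
Proof. by rewrite -int01_deriv derivM linearD /= addrK. Qed.

Lemma horner_le p (a b : R) : a <= b -> (forall x, a < x < b -> 0 <= p^`().[x]) ->
  p.[a] <= p.[b].
Proof.
move=> ab dp; apply: (@ger0_derive1_le_cc _ (horner p) a b) => //.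
- by move=> x /[!in_itv]/= xab; rewrite -derivE dp.
- by apply: continuous_subspaceT => x; exact: continuous_horner.
- by rewrite in_itv/= lexx.
- by rewrite in_itv/= lexx andbT.
Qed.

(** The coefficient at index 0 is a division by zero, hence 0: this is the antiderivative that
    vanishes at 0. *)
Definition prim p : {poly R} := \poly_(i < (size p).+1) (p`_i.-1 / i%:R).

Lemma deriv_prim p : (prim p)^`() = p.
Proof.
apply/polyP => i; rewrite coef_deriv coef_poly ltnS /=.
case: ltnP => [ip|/(nth_default 0) ->]; last by rewrite mul0rn.
by rewrite -(mulr_natr (_ / _)) divfK ?pnatr_eq0.
Qed.

Lemma int01_ge0 p : (forall x, 0 < x < 1 -> 0 <= p.[x]) -> 0 <= int01 p.
Proof.
move=> p0; rewrite -(deriv_prim p) int01_deriv subr_ge0.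
by apply: horner_le => // x; rewrite deriv_prim; exact: p0.
Qed.

Lemma poly_eq0_itv p (a b : R) : a < b -> (forall x, a <= x <= b -> p.[x] = 0) -> p = 0.
Proof.
move=> ab p0; apply/eqP; apply: contraT => pn0.
(* As many distinct roots in the interval as [size p], one more than a nonzero [p] can have. *)
pose s := [seq a + (b - a) / k.+1%:R | k <- iota 0 (size p)].
suff : (size s < size p)%N by rewrite size_map size_iota ltnn.
apply: max_poly_roots => //.
  apply/allP => _ /mapP[k _ ->]; apply/rootP/p0.
  have k0 : (0 : R) < k.+1%:R by rewrite ltr0n.
  rewrite lerDl divr_ge0 ?subr_ge0 ?(ltW ab)//=.
  by rewrite addrC -lerBrDr ler_pdivrMr// ler_peMr ?subr_ge0 ?(ltW ab)// ler1n.
rewrite map_inj_uniq ?iota_uniq// => i j /addrI /mulfI.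
rewrite subr_eq0 gt_eqF// => /(_ isT) /invr_inj /eqP.
by rewrite eqr_nat => /eqP[].
Qed.

Lemma int01_sqr_ge0 p : 0 <= int01 (p * p).
Proof. by apply: int01_ge0 => x _; rewrite hornerM -expr2 sqr_ge0. Qed.

(** The antiderivative of [p * p] is nondecreasing and agrees at 0 and 1, so it is constant on
    [0,1], hence constant as a polynomial, and its derivative vanishes. *)
Lemma int01_sqr_eq0 p : int01 (p * p) = 0 -> p = 0.
Proof.
move=> I0; pose P := prim (p * p).
have P' : P^`() = p * p by exact: deriv_prim.
have mono a b : a <= b -> P.[a] <= P.[b].
  by move=> ab; apply: horner_le => // x _; rewrite P' hornerM -expr2 sqr_ge0.
have P01 : P.[1] = P.[0].
  by apply/eqP; rewrite -subr_eq0 -int01_deriv P' I0.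
have Pc : P - P.[0]%:P = 0.
  apply: (@poly_eq0_itv _ 0 1) => // x /andP[x0 x1].
  rewrite hornerD hornerN hornerC; apply/eqP.
  by rewrite subr_eq0 eq_le -{1}P01 !mono.
have : (P - P.[0]%:P)^`() = 0 by rewrite Pc deriv0.
rewrite derivB derivC subr0 P' => /eqP.
by rewrite mulf_eq0 orbb => /eqP.
Qed.

(* q is a scalar multiple of the n-th shifted Legendre polynomial. *)
Section orthogonal.
Variables (n : nat) (q : {poly R}).
Hypothesis sq : size q = n.+1.
Hypothesis oq : forall r, (size r <= n)%N -> int01 (q * r) = 0.

Let q_gt j : (n < j)%N -> q`_j = 0.
Proof. by move=> nj; rewrite nth_default// sq. Qed.

(* Integrate ((X - c) q^2)' and note that (X - c) q' - n q has degree < n; the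
   cases c = 0 and c = 1 give q(1)^2 and q(0)^2. *)
Lemma orth_ends c :
  (1 - c) * q.[1] ^+ 2 + c * q.[0] ^+ 2 = (n.*2.+1)%:R * int01 (q * q).
Proof.
have szr : (size (('X - c%:P) * q^`() - n%:R *: q)%R <= n)%N.
  apply/leq_sizeP => j nj; rewrite coefB coefZ mulrBl coefB coefXM coefCM.
  rewrite !coef_deriv (q_gt (_ : n < j.+1)%N)// mul0rn mulr0 subr0.
  case: j nj => [|j].
    by rewrite leqn0 => /eqP ->; rewrite eqxx mul0r subrr.
  rewrite leq_eqVlt => /predU1P[->|nj] /=; first by rewrite mulr_natl subrr.
  by rewrite q_gt// mul0rn mulr0 subrr.
have := oq szr; have /esym := int01_deriv (('X - c%:P) * (q * q)).
have -> : (('X - c%:P) * (q * q))^`() =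
    (n.*2.+1)%:R *: (q * q) + (q * (('X - c%:P) * q^`() - n%:R *: q)) *+ 2.
  have sE k (s : {poly R}) : k%:R *: s = k%:R * s by rewrite scaler_nat mulr_natl.
  by rewrite !derivM derivXsubC !sE -addnn; ring.
rewrite linearD linearZ linearMn /= => + h; rewrite h mul0rn addr0 => <-.
by rewrite !hornerM !hornerXsubC -!expr2; ring.
Qed.

Let f : {poly R} := 'X^2 - 'X.
(** The Legendre differential operator on [0,1]. By [coefL] it does not raise degrees and multiplies
    the coefficient of degree [n] of a polynomial of degree [n] by [n * n.+1]. *)
Let L r := (f * r^`())^`().

Let coefL r j : (L r)`_j = j.+1%:R * (j%:R * r`_j - j.+1%:R * r`_j.+1).
Proof.
rewrite coef_deriv mulrBl coefB coefXnM coefXM /= !coef_deriv -[LHS]mulr_natl.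
congr (_ * _); case: j => [|j] /=; first by rewrite mul0r mul1r mulr1n.
by rewrite subn2 /= !mulr_natl.
Qed.

Let f0 : f.[0] = 0. Proof. by rewrite !hornerE expr2 mul0r subrr. Qed.
Let f1 : f.[1] = 0. Proof. by rewrite !hornerE expr1n subrr. Qed.

(** Two integrations by parts; the boundary terms vanish because [f] does at 0 and 1. *)
Let L_sym r s : int01 (L r * s) = int01 (r * L s).
Proof.
rewrite /L int01_by_parts [in RHS]mulrC int01_by_parts.
rewrite !hornerM f0 f1 !mul0r !subrr !sub0r; congr (- int01 _); ring.
Qed.

(** The difference [s] of the two sides has degree below [n], since the top coefficients cancel. So
    does [L s], and by symmetry of [L] and orthogonality of [q], [s] is orthogonal to itself. *)
Let orth_ode : L q = (n * n.+1)%:R *: q.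
Proof.
pose s := L q - (n * n.+1)%:R *: q.
have ss : (size s <= n)%N.
  apply/leq_sizeP => j; rewrite coefB coefZ coefL leq_eqVlt => /predU1P[<-|nj].
    by rewrite (q_gt (ltnSn _)) natrM; ring.
  by rewrite (q_gt nj) (q_gt (leqW nj)) !mulr0 subrr mulr0 subrr.
apply/eqP; rewrite -subr_eq0; apply/eqP/int01_sqr_eq0.
rewrite -/s {1}/s mulrBl linearB /= L_sym -scalerAl linearZ /=.
rewrite !oq ?mulr0 ?subrr//; apply/leq_sizeP => j nj.
by rewrite coefL !(nth_default 0 (leq_trans ss _)) ?(leqW nj)// !mulr0 subrr mulr0.
Qed.

Lemma orth_bound x : 0 <= x <= 1 ->
  q.[x] ^+ 2 <= (n.*2.+1)%:R * int01 (q * q).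
Proof.
move=> /andP[x0 x1].
have q1 : q.[1] ^+ 2 = n.*2.+1%:R * int01 (q * q).
  by rewrite -(orth_ends 0); ring.
have q0 : q.[0] ^+ 2 = n.*2.+1%:R * int01 (q * q).
  by rewrite -(orth_ends 1); ring.
(* Constant [q] is treated apart, because the factor [N] below has to be positive to be
   cancelled. *)
have [n0|n0] := eqVneq n 0.
  by rewrite -q0; have /size1_polyC -> : (size q <= 1)%N;
    rewrite ?sq ?n0// !hornerC.
pose N : R := (n * n.+1)%:R.
have N0 : 0 < N by rewrite ltr0n muln_gt0 lt0n n0.
(* F >= N q^2 on [0, 1] and, by the Legendre equation, F' = f' q'^2, so F is
   maximal at the end points, where it equals N q^2. *)
pose F := N *: (q * q) - f * (q^`() * q^`()).
have F' : F^`() = f^`() * (q^`() * q^`()).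
  have ode : f^`() * q^`() + f * q^`()^`() = N *: q.
    by rewrite -derivM; exact: orth_ode.
  rewrite /F derivB derivZ !derivM.
  rewrite (_ : N *: _ = (N *: q) * q^`() *+ 2); last first.
    by rewrite -!mul_polyC; ring.
  by rewrite -ode; ring.
have fp y : f^`().[y] = 2 * y - 1.
  by rewrite /f derivB derivXn derivX !hornerE/= mulr2n; ring.
have NF y : 0 <= y <= 1 -> N * q.[y] ^+ 2 <= F.[y].
  move=> /andP[y0 y1]; rewrite /F hornerD hornerN hornerZ !hornerM -!expr2.
  rewrite lerDl oppr_ge0 mulr_le0_ge0 ?sqr_ge0//.
  by rewrite /f hornerD hornerN hornerXn hornerX; nra.
have Fe y : f.[y] = 0 -> F.[y] = N * q.[y] ^+ 2.
  by move=> fy; rewrite hornerD hornerN hornerZ !hornerM fy; ring.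
rewrite -(ler_pM2l N0); apply: le_trans (NF x _) _; first by rewrite x0.
(* Since [f' = 2y - 1], [F] increases on [1/2,1] and decreases on [0,1/2]: compare with the end
   point on the side of [x]. *)
have [xh|xh] := lerP (1 / 2) x.
  rewrite -q1 -Fe//; apply: horner_le => // y /andP[xy y1].
  rewrite F' hornerM fp mulr_ge0//; first by lra.
  by rewrite hornerM -expr2 sqr_ge0.
rewrite -q0 -Fe// -lerN2 -!hornerN; apply: horner_le => // y /andP[xy y1].
rewrite derivN hornerN F' hornerM fp oppr_ge0 mulr_le0_ge0//; first by lra.
by rewrite hornerM -expr2 sqr_ge0.
Qed.

End orthogonal.

End poly01.

(** * The Hilbert matrix as a Gram matrix, and [w] as a reproducing kernel *)

Section hilbert.
Context {R : realType}.
Implicit Types (p q r : {poly R}) (m n : nat).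

Definition sum_monom m (v : 'I_m -> R) : {poly R} := \sum_(i < m) v i *: 'X^i.

Lemma size_sum_monom m (v : 'I_m -> R) : (size (sum_monom v) <= m)%N.
Proof.
rewrite (leq_trans (size_sum _ _ _))//; apply/bigmax_leqP => i _.
by rewrite (leq_trans (size_scale_leq _ _))// size_polyXn.
Qed.

Lemma poly_sum_monom m r : (size r <= m)%N -> r = sum_monom (fun i : 'I_m => r`_i).
Proof.
move=> rm; rewrite -[LHS](coefK r) poly_def.
rewrite (big_ord_widen m (fun i => r`_i *: 'X^i) rm) big_mkcond /=.
apply: eq_bigr => i _; case: ltnP => // /(nth_default 0) ->.
by rewrite scale0r.
Qed.

Lemma int01_sum_monom m (v : 'I_m -> R) r : (size r <= m)%N ->
  int01 (sum_monom v * r) = \sum_(j < m) r`_j * \sum_(i < m) v i / (i + j + 1)%:R.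
Proof.
move=> /poly_sum_monom {1}->; rewrite mulr_sumr linear_sum /=.
apply: eq_bigr => j _; rewrite -scalerAr linearZ /= mulr_suml linear_sum /=.
congr (_ * _); apply: eq_bigr => i _.
by rewrite -scalerAl linearZ /= -exprD int01Xn addn1.
Qed.

(** The matrix is the Gram matrix of the monomials: a kernel vector gives a polynomial orthogonal to
    every monomial of degree below [m], hence to itself, hence zero. *)
Lemma hilbert_mx_unit m : hilbert_mx m \in @unitmx R m.
Proof.
rewrite unitmxE unitfE; apply/det0P => -[v v0 vH].
pose r := sum_monom (v 0).
have vHj (j : 'I_m) : \sum_(i < m) v 0 i / (i + j + 1)%:R = 0.
  have := congr1 (fun M : 'rV_m => M 0 j) vH; rewrite !mxE => vHj.
  rewrite -[RHS]vHj; by apply: eq_bigr => i _; rewrite !mxE.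
have r0 : r = 0.
  apply: int01_sqr_eq0; rewrite int01_sum_monom ?size_sum_monom//.
  by apply: big1 => j _; rewrite vHj mulr0.
move/eqP : v0; apply; apply/rowP => j; rewrite mxE.
have := congr1 (fun p => p`_j) r0; rewrite coef0 => rj; rewrite -[RHS]rj.
rewrite /r /sum_monom coef_sum (bigD1 j)//= coefZ coefXn eqxx mulr1.
rewrite big1 ?addr0// => i ij; rewrite coefZ coefXn.
by rewrite (_ : (j : nat) == i = false) ?mulr0// eq_sym; exact/negbTE.
Qed.

(** Riesz representer, for the [int01] inner product on polynomials of degree below [m], of the
    functional sending each ['X^j] to [b j 0]. *)
Definition riesz m (b : 'cV[R]_m) : {poly R} :=
  sum_monom (fun i => (invmx (hilbert_mx m) *m b) i 0).

Lemma size_riesz m (b : 'cV[R]_m) : (size (riesz b) <= m)%N.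
Proof. exact: size_sum_monom. Qed.

Lemma int01_riesz m (b : 'cV[R]_m) r : (size r <= m)%N ->
  int01 (riesz b * r) = \sum_(j < m) r`_j * b j 0.
Proof.
move=> rm; rewrite int01_sum_monom//; apply: eq_bigr => j _; congr (_ * _).
rewrite -[in RHS](mulKVmx (hilbert_mx_unit m) b) mxE; apply: eq_bigr => i _.
by rewrite [in RHS]mxE [RHS]mulrC (addnC i).
Qed.

(** One Gram-Schmidt step: [b] lists the inner products of ['X^n] with lower monomials, so [riesz b]
    is its orthogonal projection; subtract it and normalise. *)
Lemma orthonormal_exists n : exists q : {poly R}, [/\ size q = n.+1,
  forall r, (size r <= n)%N -> int01 (q * r) = 0 & int01 (q * q) = 1].
Proof.
pose b : 'cV[R]_n := \col_j (n + j + 1)%:R^-1.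
pose q := 'X^n - riesz b.
have sq : size q = n.+1.
  by rewrite size_polyDl size_polyXn// size_polyN ltnS size_riesz.
have oq r : (size r <= n)%N -> int01 (q * r) = 0.
  move=> rn; rewrite mulrBl linearB /= int01_riesz//.
  rewrite {1}(poly_sum_monom rn) mulr_sumr linear_sum /= -sumrB.
  apply: big1 => j _; rewrite mxE -scalerAr linearZ /= -exprD int01Xn.
  by rewrite addn1 subrr.
pose c := int01 (q * q).
have c0 : 0 < c.
  rewrite lt_def int01_sqr_ge0 andbT; apply/eqP => /int01_sqr_eq0 q0.
  by move: sq; rewrite q0 size_poly0.
have s0 : (Num.sqrt c)^-1 != 0 by rewrite invr_eq0 gt_eqF// sqrtr_gt0.
exists ((Num.sqrt c)^-1 *: q); split; first by rewrite size_scale.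
  by move=> r rn; rewrite -scalerAl linearZ /= oq// mulr0.
rewrite -scalerAl -scalerAr !linearZ /= -/c mulrA -expr2 exprVn sqr_sqrtr ?ltW//.
by rewrite mulVf// gt_eqF.
Qed.

(** The moments [x ^+ i] are the values of the monomials at [x], so this represents evaluation at
    [x]. *)
Definition w_poly m (x : R) : {poly R} := riesz (\col_(i < m) x ^+ i).

Lemma horner_w_poly m (x z : R) : (w_poly m x).[z] = w m x z.
Proof.
rewrite /w_poly /riesz /sum_monom horner_sum; apply: eq_bigr => i _.
by rewrite hornerZ hornerXn.
Qed.

Lemma int01_w_poly m (x : R) r : (size r <= m)%N -> int01 (w_poly m x * r) = r.[x].
Proof.
move=> rm; rewrite int01_riesz// [in RHS](poly_sum_monom rm) horner_sum.
by apply: eq_bigr => j _; rewrite mxE hornerZ hornerXn.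
Qed.

Lemma w_diag_le m (x : R) : 0 <= x <= 1 -> w m x x <= m%:R ^+ 2.
Proof.
move=> x01; have /choice[e eP] := orthonormal_exists.
pose v n := \sum_(j < n) (e j).[x] *: e j.
have sv n : (size (v n) <= n)%N.
  rewrite (leq_trans (size_sum _ _ _))//; apply/bigmax_leqP => i _.
  by rewrite (leq_trans (size_scale_leq _ _))//; have [-> _ _] := eP i.
have vS n : v n.+1 = v n + (e n).[x] *: e n by rewrite /v big_ord_recr.
have vP n r : (size r <= n)%N -> int01 (v n * r) = r.[x].
  elim: n r => [|n IHn] r.
    by rewrite leqn0 size_poly_eq0 => /eqP ->; rewrite mulr0 linear0 horner0.
  move=> rn; have [sen oen nen] := eP n.
  have ln0 : (e n)`_n != 0.
    by rewrite -[n in _`_n]/n.+1.-1 -sen -lead_coefE lead_coef_eq0 -size_poly_eq0 sen.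
  (* Subtracting [c *: e n] cancels the coefficient of degree [n], which brings the rest of [r]
     under the induction hypothesis. *)
  pose c := r`_n / (e n)`_n.
  have rE : r = (r - c *: e n) + c *: e n by rewrite subrK.
  have rn' : (size (r - c *: e n)%R <= n)%N.
    apply/leq_sizeP => j; rewrite leq_eqVlt coefB coefZ => /predU1P[<-|nj].
      by rewrite /c divfK// subrr.
    by rewrite !nth_default ?mulr0 ?subrr// ?sen// (leq_trans rn).
  rewrite rE; move: (r - _) rn' => s sn; rewrite vS mulrDl !mulrDr !linearD /=.
  rewrite IHn// -!scalerAl -!scalerAr !linearZ /= oen// nen.
  rewrite (mulrC (v n)) oen// hornerD hornerZ; ring.
(* Both sides reproduce evaluation at [x] below degree [m], so their difference is orthogonal to
   itself. *)
have wv : w_poly m x = v m.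
  apply/eqP; rewrite -subr_eq0; apply/eqP/int01_sqr_eq0.
  have sd : (size (w_poly m x - v m)%R <= m)%N.
    by rewrite (leq_trans (size_polyD _ _))// geq_max size_polyN sv size_riesz.
  by rewrite {1}mulrBl linearB /= int01_w_poly// vP// subrr.
rewrite -horner_w_poly wv; elim: m {wv} => [|n IHn].
  by rewrite /v big_ord0 horner0 expr2 mul0r.
have [sen oen nen] := eP n.
rewrite vS hornerD hornerZ -expr2 (le_trans (lerD IHn (orth_bound sen oen x01)))//.
by rewrite nen -addnn -!natr1 natrD; lra.
Qed.

Lemma int01_w_poly_sqr m (x : R) : 0 <= x <= 1 ->
  int01 (w_poly m x * w_poly m x) <= m%:R ^+ 2.
Proof. by move=> x01; rewrite int01_w_poly ?size_riesz// horner_w_poly w_diag_le. Qed.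

End hilbert.

(** * Lebesgue integration over the cube, one coordinate at a time *)

Section cube_integral.
Context {R : realType}.
Local Notation T := (measurableTypeR R).
Local Notation leb := (@lebesgue_measure R).

Lemma integral_poly01 (p : {poly R}) :
  (\int[leb]_(t in `[0%R, 1%R]) (p.[t])%:E = (int01 p)%:E)%E.
Proof.
rewrite (@continuous_FTC2 _ _ (horner (prim p)))//.
- by rewrite -EFinB -int01_deriv deriv_prim.
- by apply: continuous_subspaceT => x; exact: continuous_horner.
- split=> [x _||]; first exact: derivable_horner.
    by apply: cvg_at_right_filter; exact: continuous_horner.
  by apply: cvg_at_left_filter; exact: continuous_horner.
- by move=> x _; rewrite -derivE deriv_prim.
Qed.

Lemma w_hornerE m (x : R) : w m x = horner (w_poly m x).
Proof. by apply/funext => t; rewrite horner_w_poly. Qed.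

Lemma measurable_w m (x : R) (D : set T) : measurable_fun D (w m x).
Proof. by rewrite w_hornerE; exact: measurable_poly. Qed.

Lemma integral_abs_w_le m (x : R) : (0 < m)%N -> 0 <= x <= 1 ->
  (\int[leb]_(t in `[0%R, 1%R]) `|w m x t|%:E <= m%:R%:E)%E.
Proof.
move=> m0 x01; have mR : 0 < m%:R :> R by rewrite ltr0n.
(* AM-GM: |w| <= w^2 / (2m) + m / 2, whose integral is known. *)
pose q := (2 * m%:R)^-1 *: (w_poly m x * w_poly m x) + (m%:R / 2)%:P.
apply: (@le_trans _ _ (\int[leb]_(t in `[0%R, 1%R]) (q.[t])%:E)%E).
  apply: ge0_le_integral => //.
  - by apply/measurable_EFinP; apply: measurableT_comp => //; exact: measurable_w.
  - by apply/measurable_EFinP; exact: measurable_poly.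
  - move=> t _; rewrite lee_fin hornerD hornerC hornerZ hornerM horner_w_poly.
    rewrite -subr_ge0; set a := w m x t.
    have -> : (2 * m%:R)^-1 * (a * a) + m%:R / 2 - `|a| =
        (2 * m%:R)^-1 * (`|a| - m%:R) ^+ 2.
      rewrite sqrrB real_normK ?num_real//; field; exact: lt0r_neq0.
    by rewrite mulr_ge0 ?sqr_ge0// invr_ge0 mulr_ge0// ltW.
rewrite integral_poly01 lee_fin linearD linearZ /=.
rewrite int01C.
have := int01_w_poly_sqr m x01; set a := int01 _ => am.
apply: (@le_trans _ _ ((2 * m%:R)^-1 * m%:R ^+ 2 + m%:R / 2)).
  by rewrite lerD2r ler_wpM2l// invr_ge0 mulr_ge0// ltW.
rewrite le_eqVlt; apply/orP; left; apply/eqP; field; exact: lt0r_neq0.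
Qed.

Lemma measurable_cube d : measurable (@cube R d).
Proof.
rewrite (_ : cube d = \bigcap_(i in [set: 'I_d]) ((tnth (T:=T))^~ i @^-1` (`[0%R, 1%R]%classic : set T))).
  apply: fin_bigcap_measurable => // i _; rewrite -[X in measurable X]setTI.
  exact: measurable_tnth.
by apply/seteqP; split=> [z zc i _ | z zc i]; [rewrite /= in_itv/= zc
  | have := zc i I; rewrite /= in_itv].
Qed.

Lemma preimage_cube d :
  @consT R d @^-1` cube d.+1 = (`[0%R, 1%R]%classic : set T) `*` cube d.
Proof.
apply/seteqP; split=> [[t z] zc|[t z] [/= t01 zc] i].
  split=> [|i] /=; first by rewrite in_itv/=; have := zc ord0; rewrite tnth0.
  by have := zc (lift ord0 i); rewrite tnthS.
case: (unliftP ord0 i) => [j ->|->]; first by rewrite tnthS; exact: zc.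
by rewrite tnth0; move: t01; rewrite in_itv.
Qed.

Lemma in_cubeS d (t : T) z : (@consT R d (t, z) \in cube d.+1) =
  (t \in (`[0%R, 1%R]%classic : set T)) && (z \in cube d).
Proof.
transitivity ((t, z) \in @consT R d @^-1` cube d.+1).
  by apply/idP/idP => /set_mem ?; apply/mem_set.
by rewrite preimage_cube in_setX.
Qed.

Lemma lebesgue_tuple_cube d : lebesgue_tuple d (@cube R d) = 1%E.
Proof.
elim: d => [|d IHd].
  by rewrite /= diracE mem_set// => -[].
rewrite /= /lebesgue_cons /pushforward preimage_cube product_measure1E//.
  rewrite IHd mule1; have := lebesgue_measure_itv (R := R) `[0%R, 1%R].
  by rewrite /= lte_fin ltr01 sube0.
exact: measurable_cube.
Qed.

Section step.
Variables (d : nat) (f : pt[R]_d.+1 -> \bar R).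
Hypothesis mf : measurable_fun (cube d.+1) f.

(** Extension by zero turns the integral over the cube into one over the whole product space, where
    Tonelli and Fubini apply. *)
Let g := (f \_ (cube d.+1)) \o @consT R d.

Let mg : measurable_fun setT g.
Proof.
apply: measurableT_comp; last exact: measurable_consT.
by apply/measurable_restrict; rewrite ?setTI//; exact: measurable_cube.
Qed.

Let gE : (fun t => \int[lebesgue_tuple d]_z g (t, z))%E =
  (fun t => \int[lebesgue_tuple d]_(z in cube d) f (consT (t, z)))%E
    \_ (`[0%R, 1%R]%classic : set T).
Proof.
apply/funext => t; rewrite patchE; case: ifPn => t01.
  rewrite [RHS]integral_mkcond; apply: eq_integral => z _.
  by rewrite /g /= !patchE in_cubeS t01.
by rewrite integral0_eq// => z _; rewrite /g /= patchE in_cubeS (negbTE t01).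
Qed.

Lemma ge0_integral_cubeS : (forall z, cube d.+1 z -> 0 <= f z)%E ->
  (\int[lebesgue_tuple d.+1]_(z in cube d.+1) f z =
   \int[leb]_(t in `[0%R, 1%R])
     \int[lebesgue_tuple d]_(z in cube d) f (consT (t, z)))%E.
Proof.
move=> f0; rewrite [LHS]integral_mkcond.
have f0' z : (0 <= (f \_ (cube d.+1)) z)%E.
  by rewrite patchE; case: ifPn => // /set_mem; exact: f0.
have mf' : measurable_fun setT (f \_ (cube d.+1)).
  by apply/measurable_restrict; rewrite ?setTI//; exact: measurable_cube.
have -> := ge0_integral_pushforward (@measurable_consT R d)
  (leb \x lebesgue_tuple d)%E measurableT mf' (fun z _ => f0' z).
rewrite preimage_setT (fubini_tonelli1 g mg) => [|z]; last exact: f0'.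
by rewrite /fubini_F gE -integral_mkcond.
Qed.

(** Fubini for signed integrands, used for the reproducing identity; the Tonelli form above serves
    the bound on the integral of [|w_prod|]. *)
Lemma integral_cubeS : (lebesgue_tuple d.+1).-integrable (cube d.+1) f ->
  (\int[lebesgue_tuple d.+1]_(z in cube d.+1) f z =
   \int[leb]_(t in `[0%R, 1%R])
     \int[lebesgue_tuple d]_(z in cube d) f (consT (t, z)))%E.
Proof.
move=> intf; rewrite [LHS]integral_mkcond.
have mf' : measurable_fun setT (f \_ (cube d.+1)).
  by apply/measurable_restrict; rewrite ?setTI//; exact: measurable_cube.
have ig : (leb \x lebesgue_tuple d)%E.-integrable setT g.
  apply/integrableP; split; first exact: mg.
  move: intf; rewrite integrable_mkcond; last exact: measurable_cube.
  case/integrableP => _; apply: le_lt_trans.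
  have mabs : measurable_fun setT (fun z => `|(f \_ (cube d.+1)) z|%E).
    exact: measurableT_comp.
  have -> := ge0_integral_pushforward (@measurable_consT R d)
    (leb \x lebesgue_tuple d)%E measurableT mabs (fun z _ => abse_ge0 _).
  by rewrite preimage_setT.
have -> := integral_pushforward (@measurable_consT R d) mf' ig measurableT.
by rewrite preimage_setT -(integral12_prod_meas1 ig) /fubini_F gE -integral_mkcond.
Qed.

End step.

End cube_integral.

(** * Reproduction of polynomials in [dist2], and the norm of the product kernel *)

Section repro.
Context {R : realType}.
Local Notation T := (measurableTypeR R).
Local Notation leb := (@lebesgue_measure R).

(** What remains of [W] times the density once [p] cancels on the cube. *)
Definition w_prod d m (x z : pt[R]_d) : R :=
  \prod_(i < d) w m (tnth x i) (tnth z i).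

Lemma w_prodS d m (x0 : R) (x' : pt[R]_d) (t : R) (z : pt[R]_d) :
  w_prod m [tuple of x0 :: x'] (consT (t, z)) = w m x0 t * w_prod m x' z.
Proof.
rewrite /w_prod big_ord_recl !tnth0; congr (_ * _).
by apply: eq_bigr => i _; rewrite !tnthS.
Qed.

Lemma dist2S d (t : R) (z : pt[R]_d) (y0 : R) (y : pt[R]_d) :
  dist2 (consT (t, z)) [tuple of y0 :: y] = (t - y0) ^+ 2 + dist2 z y.
Proof.
rewrite /dist2 big_ord_recl !tnth0; congr (_ + _).
by apply: eq_bigr => i _; rewrite !tnthS.
Qed.

Lemma cube_cons d (y0 : R) (y : pt[R]_d) :
  cube d.+1 [tuple of y0 :: y] -> 0 <= y0 <= 1 /\ cube d y.
Proof.
move=> yc; split; first by have := yc ord0; rewrite tnth0.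
by move=> i; have := yc (lift ord0 i); rewrite tnthS.
Qed.

Lemma measurable_w_prod d m (x : pt[R]_d) (D : set pt[R]_d) :
  measurable_fun D (w_prod m x).
Proof.
apply: measurable_funTS; apply: measurable_prod => i _.
by apply: measurableT_comp; [exact: measurable_w|exact: measurable_tnth].
Qed.

Lemma measurable_dist2 d (y : pt[R]_d) (D : set pt[R]_d) :
  measurable_fun D (fun z => dist2 z y).
Proof.
apply: measurable_funTS; apply: measurable_sum => i.
by apply: measurable_funX; apply: measurable_funB => //; exact: measurable_tnth.
Qed.

Lemma integral_cube_cst d (r : \bar R) :
  (\int[lebesgue_tuple d]_(z in cube d) cst r z = r)%E.
Proof.
transitivity (r * lebesgue_tuple d (cube d))%E; last by rewrite lebesgue_tuple_cube mule1.
exact: (integral_cst _ (@measurable_cube R d)).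
Qed.

Lemma integral_abs_w_prod_le d m (x : pt[R]_d) : (0 < m)%N -> cube d x ->
  (\int[lebesgue_tuple d]_(z in cube d) `|w_prod m x z|%:E <= (m%:R ^+ d)%:E)%E.
Proof.
move=> m0; have mabs k (u : pt[R]_k) :
    measurable_fun (cube k) (fun z => `|w_prod m u z|%:E).
  apply/measurable_EFinP; apply: measurableT_comp => //.
  exact: measurable_w_prod.
elim: d x => [|d IHd] x xc.
  rewrite (eq_integral (cst 1%E)) => [|z _]; last first.
    by rewrite /w_prod big_ord0 normr1.
  by rewrite integral_cube_cst expr0.
rewrite ge0_integral_cubeS; [|exact: mabs|by move=> z _; rewrite lee_fin].
case/tupleP: x xc => x0 x /cube_cons[x01 xc].
pose K := (\int[lebesgue_tuple d]_(z in cube d) `|w_prod m x z|%:E)%E.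
have K0 : (0 <= K)%E by exact: integral_ge0.
rewrite (eq_integral (fun t : T => `|w m x0 t|%:E * K)%E) => [|t _]; last first.
  rewrite -ge0_integralZl//; [|exact: measurable_cube|exact: mabs].
  by apply: eq_integral => z _; rewrite w_prodS normrM EFinM.
rewrite ge0_integralZr//; last first.
  by apply/measurable_EFinP; apply: measurableT_comp => //; exact: measurable_w.
rewrite exprS EFinM lee_pmul//; first exact: integral_ge0.
  exact: integral_abs_w_le.
exact: IHd.
Qed.

Lemma poly_bounded (p : {poly R}) (B : R) :
  exists M, forall t, `|t| <= B -> `|p.[t]| <= M.
Proof.
exists (\sum_(i < size p) `|p`_i| * B ^+ i) => t tB.
rewrite horner_coef (le_trans (ler_norm_sum _ _ _))//.
apply: ler_sum => i _; rewrite normrM normrX ler_wpM2l// lerXn2r// nnegrE//.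
exact: le_trans tB.
Qed.

Lemma dist2_cube d (x y : pt[R]_d) : cube d x -> cube d y -> 0 <= dist2 x y <= d%:R.
Proof.
move=> xc yc; rewrite sumr_ge0/= => [|i _]; last exact: sqr_ge0.
rewrite (le_trans (ler_sum _ (G := fun=> 1) _))//.
  by move=> i _; have /andP[? ?] := xc i; have /andP[? ?] := yc i; nra.
by rewrite sumr_const card_ord.
Qed.

Lemma integrable_poly_w_prod d m (p : {poly R}) (c : R) (x y : pt[R]_d) :
  cube d y -> (lebesgue_tuple d).-integrable (cube d)
    (fun z => (p.[c + dist2 z y] * w_prod m x z)%:E).
Proof.
move=> yc; apply: measurable_bounded_integrable.
- exact: measurable_cube.
- by apply: (@le_lt_trans _ _ (1%E : \bar R)); [rewrite -(@lebesgue_tuple_cube R d)|rewrite ltry].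
- apply: measurable_funM; last exact: measurable_w_prod.
  apply: measurableT_comp; first exact: measurable_poly.
  by apply: measurable_funD => //; exact: measurable_dist2.
(* On the cube [dist2 z y] lies between 0 and [d], so the argument of [p] is at most [|c| + d] in
   modulus. *)
have [M MP] := poly_bounded p (`|c| + d%:R).
have /choice[N NP] (i : 'I_d) : exists N, forall t, `|t| <= 1 -> `|w m (tnth x i) t| <= N.
  by rewrite w_hornerE; exact: poly_bounded.
exists (M * \prod_i N i); split; first exact: num_real.
move=> r Mr z zc /=; apply: le_trans (ltW Mr).
rewrite normrM ler_pM//.
  apply: MP; rewrite (le_trans (ler_normD _ _))// lerD2l.
  by have /andP[? ?] := dist2_cube zc yc; rewrite ger0_norm.
rewrite normr_prod ler_prod// => i _; rewrite normr_ge0/= NP//.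
by have /andP[? ?] := zc i; rewrite ger0_norm.
Qed.

(* Stated with a shift c so that the induction on the dimension can absorb the
   squared differences of the coordinates already integrated out. *)
Lemma integral_poly_w_prod d m n (p : {poly R}) (c : R) (x y : pt[R]_d) :
  (size p <= n.+1)%N -> (n.*2 < m)%N -> cube d y ->
  (\int[lebesgue_tuple d]_(z in cube d)
    (p.[c + dist2 z y] * w_prod m x z)%:E = p.[c + dist2 x y]%:E)%E.
Proof.
move=> pn nm; elim: d c x y => [|d IHd] c x y yc.
  rewrite (eq_integral (cst p.[c + dist2 x y]%:E)) => [|z _]; last first.
    by rewrite /w_prod /dist2 !big_ord0 mulr1.
  by rewrite integral_cube_cst.
have ip := integrable_poly_w_prod m p c x yc.
rewrite integral_cubeS//; last exact: measurable_int ip.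
case/tupleP: x {ip} => x0 x; case/tupleP: y yc => y0 y /cube_cons[_ yc].
(* By the induction hypothesis with shift [c + (t - y0) ^+ 2], integrating out the other coordinates
   leaves [q.[t]], of degree at most [2n < m]. *)
pose q := p \Po ((c + dist2 x y)%:P + ('X - y0%:P) ^+ 2).
have qE t : q.[t] = p.[c + (t - y0) ^+ 2 + dist2 x y].
  rewrite /q horner_comp hornerD hornerC horner_exp hornerXsubC.
  by congr _.[_]; ring.
have sq : (size q <= m)%N.
  rewrite (leq_trans (size_comp_poly_leq _ _))//.
  have s2 : (size ((c + dist2 x y)%:P + ('X - y0%:P) ^+ 2)%R <= 3)%N.
    rewrite (leq_trans (size_polyD _ _))// geq_max size_exp_XsubC andbT.
    by rewrite (leq_trans (size_polyC_leq1 _)).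
  rewrite (leq_ltn_trans _ nm)// -muln2 leq_mul//; first by rewrite -subn1 leq_subLR.
  by rewrite -subn1 leq_subLR.
rewrite (eq_integral (fun t : T => (w_poly m x0 * q).[t]%:E)) => [|t _]; last first.
  rewrite hornerM horner_w_poly qE EFinM -IHd// -integralZl//.
  - by apply: eq_integral => z _; rewrite w_prodS dist2S addrA mulrCA EFinM.
  - exact: measurable_cube.
  - exact: integrable_poly_w_prod.
by rewrite integral_poly01 int01_w_poly// qE (dist2S x0) addrA.
Qed.

End repro.

(** * The density constant, the Taylor remainder and the pointwise error *)

Section error_bound.
Context {R : realType}.

Lemma inv_density_sup_ge1 d (P : probability pt[R]_d R) (p : pt[R]_d -> R) :
  has_density P p -> (0 < ereal_inf [set (p z)%:E | z in cube d])%E ->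
  (forall z, cube d z -> 0 < p z) /\ 1 <= inv_density_sup p.
Proof.
case=> mp p0 Pp inf0.
have inf_le z : cube d z -> (ereal_inf [set (p z)%:E | z in cube d] <= (p z)%:E)%E.
  by move=> zc; apply: ereal_inf_lbound; exists z.
have pgt z : cube d z -> 0 < p z.
  by move=> /inf_le; rewrite -lte_fin; exact: lt_le_trans.
split=> //; pose o : pt[R]_d := [tuple 0 | i < d].
have oc : cube d o by move=> i; rewrite tnth_mktuple lexx ler01.
(* A positive real lower bound of [p] bounds the inverses above, so [sup] is a genuine supremum and
   not its default value. The point [o] excludes an infinite infimum. *)
have [b b0 bp] : exists2 b : R, 0 < b & forall z, cube d z -> b <= p z.
  have := inf_le o oc; move: inf0 inf_le; case: (ereal_inf _) => [b|_ _|]//.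
  by rewrite lte_fin => b0 bp _; exists b => // z /bp; rewrite lee_fin.
have le_sup z : cube d z -> (p z)^-1 <= inv_density_sup p.
  move=> zc; apply: ub_le_sup; last by exists z.
  by exists b^-1 => _ [t tc <-]; rewrite lef_pV2 ?posrE ?pgt// bp.
set c := inv_density_sup p in le_sup *.
have c0 : 0 < c by rewrite (lt_le_trans _ (le_sup _ oc))// invr_gt0 pgt.
rewrite -invf_le1// -lee_fin -(probability_setT P) Pp// setTI.
rewrite -[leLHS](integral_cube_cst d).
apply: ge0_le_integral => //.
- exact: measurable_cube.
- by move=> z _; rewrite lee_fin invr_ge0 ltW.
- by apply/measurable_EFinP.
- by move=> z zc; rewrite lee_fin -[leRHS]invrK lef_pV2 ?posrE ?invr_gt0 ?pgt// le_sup.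
Qed.

Variables (d m n : nat) (phi : R -> R) (a : nat -> R) (E : R).
Hypothesis m0 : (0 < m)%N.
Hypothesis nm : (n.*2 < m)%N.
Hypothesis taylor : forall u, 0 <= u <= d%:R ->
  series (fun l => a l / l`!%:R * u ^+ l) @ \oo --> phi u.
Hypothesis tailE :
  (\sum_(n.+1 <= l <oo) (`|a l| / l`!%:R * d%:R ^+ l)%:E = E%:E)%E.

Definition taylor_poly : {poly R} := \poly_(l < n.+1) (a l / l`!%:R).

(** Past index [n], a partial sum differs from [taylor_poly] by terms that [u <= d] bounds by those
    of the tail; then pass to the limit. *)
Lemma taylor_remainder_le u : 0 <= u <= d%:R ->
  `|phi u - taylor_poly.[u]| <= E.
Proof.
move=> u01; have /andP[u0 ud] := u01.
pose s := series (fun l => a l / l`!%:R * u ^+ l).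
have cv : `|s N - taylor_poly.[u]| @[N --> \oo] --> `|phi u - taylor_poly.[u]|.
  by apply: cvg_norm; apply: cvgB; [exact: taylor|exact: cvg_cst].
rewrite -(cvg_lim _ cv)//; apply: limr_le; first by apply/cvg_ex; eexists; exact: cv.
near=> N; have nN : (n.+1 <= N)%N by near: N; exact: nbhs_infty_ge.
rewrite /s /series /= (big_cat_nat _ nN)//= horner_poly big_mkord addrAC subrr add0r.
rewrite -lee_fin -tailE.
apply: (@le_trans _ _ (\sum_(n.+1 <= l < N) (`|a l| / l`!%:R * d%:R ^+ l)%:E)%E).
  rewrite sumEFin lee_fin (le_trans (ler_norm_sum _ _ _))//.
  apply: ler_sum => l _; rewrite !normrM normfV normr_nat normrX (ger0_norm u0).
  by rewrite ler_wpM2l ?lerXn2r ?nnegrE// divr_ge0.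
apply: nneseries_lim_ge => l _; rewrite lee_fin mulr_ge0 ?divr_ge0 ?exprn_ge0//.
Unshelve. all: by end_near. Qed.

Variables x y : pt[R]_d.
Hypotheses (xc : cube d x) (yc : cube d y).

Let E0 : 0 <= E.
Proof.
by rewrite (le_trans _ (taylor_remainder_le (dist2_cube xc yc))).
Qed.

(** The [0 +] matches the shift [c] of [integral_poly_w_prod]. *)
Let r z := phi (dist2 z y) - taylor_poly.[0 + dist2 z y].

Let rE z : cube d z -> `|r z| <= E.
Proof.
by move=> zc; rewrite /r add0r taylor_remainder_le// dist2_cube.
Qed.

Let mr : measurable_fun (cube d) r.
Proof.
apply: measurable_funB.
  (* Measurability of [phi] along [dist2] comes from the pointwise limit of the Taylor partial
     sums. *)
  apply: (measurable_fun_cvg (h := fun N z =>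
    series (fun l => a l / l`!%:R * dist2 z y ^+ l) N)) => [N|z zc]; last first.
    exact/taylor/dist2_cube.
  apply: measurable_sum => l; apply: measurable_funM => //.
  by apply: measurable_funX; exact: measurable_dist2.
apply: measurableT_comp; first exact: measurable_poly.
by apply: measurable_funD => //; exact: measurable_dist2.
Qed.

Let integrable_r :
  (lebesgue_tuple d).-integrable (cube d) (fun z => (r z * w_prod m x z)%:E).
Proof.
(* Domination by the constant polynomial [E] times [w_prod], already known to be integrable. *)
apply: (le_integrable (measurable_cube (d := d)) _ _
  (integrable_poly_w_prod m E%:P 0 x yc)).
  by apply/measurable_EFinP; apply: measurable_funM => //; exact: measurable_w_prod.
move=> z zc; rewrite !abse_EFin lee_fin !normrM hornerC ler_wpM2r//.
by rewrite (ger0_norm E0) rE.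
Qed.

Lemma kernel_error_le :
  (`|\int[lebesgue_tuple d]_(z in cube d) (phi (dist2 z y) * w_prod m x z)%:E
     - (phi (dist2 x y))%:E| <= ((1 + m%:R ^+ d) * E)%:E)%E.
Proof.
have mc : measurable (@cube R d) by exact: measurable_cube.
pose J := (\int[lebesgue_tuple d]_(z in cube d) (r z * w_prod m x z)%:E)%E.
have JE : (`|J| <= (E * m%:R ^+ d)%:E)%E.
  apply: le_trans (le_abse_integral _ mc (measurable_int _ integrable_r)) _.
  apply: (@le_trans _ _
    (\int[lebesgue_tuple d]_(z in cube d) (E%:E * `|w_prod m x z|%:E))%E).
    apply: ge0_le_integral => //.
    - by apply: measurableT_comp => //; exact: measurable_int integrable_r.
    - apply: measurable_funeM; apply/measurable_EFinP; apply: measurableT_comp => //.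
      exact: measurable_w_prod.
    - move=> z zc; rewrite abse_EFin -EFinM lee_fin normrM ler_wpM2r//.
      exact: rE.
  rewrite ge0_integralZl//; last first.
    by apply/measurable_EFinP; apply: measurableT_comp => //; exact: measurable_w_prod.
  by rewrite EFinM lee_wpmul2l ?lee_fin//; exact: integral_abs_w_prod_le.
rewrite (eq_integral (fun z => (taylor_poly.[0 + dist2 z y] * w_prod m x z)%:E
    + (r z * w_prod m x z)%:E)%E) => [|z _]; last first.
  by rewrite -EFinD -mulrDl addrC subrK.
rewrite integralD//; last exact: integrable_poly_w_prod.
rewrite (integral_poly_w_prod _ _ (size_poly _ _) nm yc) add0r -/J.
(* [JE] excludes infinite values of [J], so the estimate finishes in the reals. *)
case: J JE => [j||]//; rewrite -EFinD !abse_EFin !lee_fin => jE.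
rewrite (_ : _ - _ = j - (phi (dist2 x y) - taylor_poly.[dist2 x y])); last by ring.
rewrite (le_trans (ler_normB _ _))// mulrDl mul1r addrC lerD// 1?mulrC//.
exact/taylor_remainder_le/dist2_cube.
Qed.

End error_bound.

Theorem theorem2p5 (R : realType) (d m : nat) (hd : (1 <= d)%N) (hm : (1 <= m)%N)
    (P : probability pt[R]_d R) (p : pt[R]_d -> R)
    (Pp : has_density P p)
    (inf_p : (0 < ereal_inf [set (p z)%:E | z in cube d])%E)
    (sup_p : (ereal_sup [set (p z)%:E | z in cube d] < +oo)%E)
    (phi : R -> R) (a : nat -> R)
    (smooth_phi : smooth_on `[0, d%:R]%classic phi)
    (taylor_phi : forall u, 0 <= u <= d%:R ->
      series (fun l => a l / l`!%:R * u ^+ l) @ \oo --> phi u) :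
  let k := radial_kernel d phi in
  (ereal_sup [set supnorm (fun y => integral_op p k (W p m x) y - (k x y)%:E)
             | x in cube d]
   <= (1 + Num.sqrt (inv_density_sup p) * m%:R ^+ d)%:E
      * \sum_(((m - 1) %/ 2).+1 <= l <oo) (`|a l| / l`!%:R * d%:R ^+ l)%:E)%E.
Proof.
lazy zeta; have [p_gt0 c_ge1] := inv_density_sup_ge1 Pp inf_p.
set c := Num.sqrt _; have c1 : 1 <= c by rewrite -[leLHS]sqrtr1 ler_wsqrtr.
set n := ((m - 1) %/ 2)%N.
have nm : (n.*2 < m)%N.
  by rewrite -muln2 (leq_ltn_trans (leq_trunc_div _ _))// subn1 ltn_predL.
have md0 : 0 <= m%:R ^+ d :> R by rewrite exprn_ge0.
have C0 : 0 < 1 + c * m%:R ^+ d by rewrite ltr_pwDl// mulr_ge0// (le_trans ler01).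
set S := (\sum_(_ <= l <oo) _)%E.
have S0 : (0 <= S)%E.
  by apply: nneseries_ge0 => l _ _; rewrite lee_fin mulr_ge0 ?divr_ge0.
(* If the tail diverges, the right-hand side is infinite because its factor is positive. *)
case SE : S S0 => [E||]// E0; last by rewrite gt0_muley ?lte_fin// leey.
rewrite lee_fin in E0.
apply: ge_ereal_sup => _ [x xc <-]; apply: ge_ereal_sup => _ [y yc <-].
(* The error is bounded with constant [1 + m ^ d]; [c1] enlarges it to the stated one. *)
apply: (@le_trans _ _ ((1 + m%:R ^+ d) * E)%:E); last first.
  by rewrite -EFinM lee_fin ler_wpM2r// lerD2l ler_peMl.
apply: le_trans (kernel_error_le hm nm taylor_phi SE xc yc).
rewrite /integral_op (eq_integral (fun z => (phi (dist2 z y) * w_prod m x z)%:E))//.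
move=> z /set_mem /p_gt0 pz.
by rewrite /radial_kernel /W -!mulrA mulVf ?mulr1// gt_eqF.
Qed.
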